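(* Let $G$ be a simple graph with vertex set $[n]=\{1,\dots,n\}$ and without isolated vertices, and let $P=\{i,j\}$ be an edge of $G$. Then $$\gamma_{1,P}=\min\bigl\{\deg_G(i)+\tau(G-N_G[i]),\ \deg_G(j)+\tau(G-N_G[j])\bigr\}.$$
   Context: A vector $\mathbf a\in\mathbb N^n$ ($\mathbb N$ includes $0$) is a $1$-cover of $G$ if $a_u+a_v\ge 1$ for every edge $\{u,v\}\in E(G)$; it is $P$-tight, for the edge $P=\{i,j\}$, if moreover $a_i+a_j=1$. Write $|\mathbf b|=b_1+\dots+b_n$. Then $\gamma_{1,P}=\min\{|\mathbf b| \mid \mathbf b\text{ is a }P\text{-tight }1\text{-cover of }G\}$. $N_G(v)$ is the set of neighbors of $v$, $N_G[v]=\{v\}\cup N_G(v)$, $\deg_G(v)=|N_G(v)|$. $G-U$ is the induced subgraph of $G$ on $V(G)\setminus U$. $\tau(H)$ is the minimum size of a vertex cover of a graph $H$ (with $\tau(H)=0$ if $H$ has no edges). *)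

(* Defs.v *)
From mathcomp Require Import all_boot.
From mathcomp Require Import boolp.

Set Implicit Arguments.
Unset Strict Implicit.
Unset Printing Implicit Defensive.

Record sgraph (V : finType) := SGraph {
  adj :> rel V;
  adj_sym : symmetric adj;
  adj_irr : irreflexive adj }.

Section Graph.
Context {V : finType}.
Implicit Types (G : sgraph V) (U C : {set V}) (v i j : V).

Definition nbh G v : {set V} := [set u | G v u].
Definition cl_nbh G v : {set V} := v |: nbh G v.
Definition deg G v : nat := #|nbh G v|.

Definition isolated G v : Prop := nbh G v = set0.

Definition vertex_cover G C : bool :=
  [forall u, forall v, G u v ==> (u \in C) || (v \in C)].

(* [arg min] is a genuine minimum only when its default satisfies the predicate;
   [set: V] is always a vertex cover. *)
Definition tau G : nat := #|[arg min_(C < [set: V] | vertex_cover G C) #|C|]|.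

Definition del_adj G U : rel {x : V | x \notin U} :=
  fun x y => G (val x) (val y).

Lemma del_adj_sym G U : symmetric (@del_adj G U).
Proof. by move=> x y; apply: adj_sym. Qed.

Lemma del_adj_irr G U : irreflexive (@del_adj G U).
Proof. by move=> x; apply: adj_irr. Qed.

Definition del G U : sgraph {x : V | x \notin U} :=
  SGraph (@del_adj_sym G U) (@del_adj_irr G U).

Definition cover1 G (a : {ffun V -> nat}) : Prop :=
  forall u v, G u v -> 1 <= a u + a v.

Definition tight1 G i j (a : {ffun V -> nat}) : Prop :=
  cover1 G a /\ a i + a j = 1.

Definition wt (b : {ffun V -> nat}) : nat := \sum_v b v.

(* Boolean via [asbool], so that [ex_minn] below yields the minimum. *)
Definition tight1_wt G i j : pred nat :=
  fun m => `[< exists b, tight1 G i j b /\ wt b = m >].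

Lemma tight1_wt_ex G i j : G i j -> exists m, tight1_wt G i j m.
Proof.
move=> Gij; pose b : {ffun V -> nat} := [ffun v => (v != j) : nat].
exists (wt b); apply/asboolP; exists b; split=> //; split=> [u v Guv|].
  rewrite !ffunE; case: eqVneq => [uj|_]; case: eqVneq => [vj|_] //.
  by rewrite uj vj adj_irr in Guv.
rewrite !ffunE eqxx; case: eqVneq => [ij|_] //.
by rewrite ij adj_irr in Gij.
Qed.

Definition gamma1 G i j (Gij : G i j) : nat := ex_minn (tight1_wt_ex Gij).

End Graph.

(* Main.v *)
(** If a tight 1-cover [b] has [b i = 0], then its support contains all
    neighbours of [i], and outside the closed neighbourhood of [i] it is a vertex
    cover of the rest of the graph; hence [wt b >= deg i + tau (G - N[i])].
    Conversely the neighbours of [i] together with a minimum vertex cover of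
    [G - N[i]] support a 0/1 tight 1-cover of exactly this weight.  Tightness
    forces [b i = 0] or [b j = 0], so [gamma1] is the smaller of the two values. *)
Require Import Defs.
From mathcomp Require Import all_boot.
From mathcomp Require Import boolp.

Lemma mem_nbh {V : finType} (G : sgraph V) (i u : V) : (u \in nbh G i) = G i u.
Proof. by rewrite inE. Qed.

Lemma vertex_coverP {V : finType} (G : sgraph V) (C : {set V}) :
  reflect (forall u v, G u v -> (u \in C) || (v \in C)) (vertex_cover G C).
Proof.
apply: (iffP forallP) => [h u v Guv|h u].
  by move/forallP/(_ v)/implyP: (h u); apply.
by apply/forallP => v; apply/implyP; apply: h.
Qed.

Lemma vertex_coverT {V : finType} (G : sgraph V) : vertex_cover G [set: V].
Proof. by apply/vertex_coverP => u v _; rewrite inE. Qed.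

Lemma tau_le {V : finType} (G : sgraph V) (C : {set V}) :
  vertex_cover G C -> tau G <= #|C|.
Proof.
by rewrite /tau; case: arg_minnP => [|D _ minD]; [exact: vertex_coverT | exact: minD].
Qed.

Lemma tau_attained {V : finType} (G : sgraph V) :
  exists2 C, vertex_cover G C & #|C| = tau G.
Proof.
rewrite /tau; case: arg_minnP => [|D coverD _]; first exact: vertex_coverT.
by exists D.
Qed.

Lemma tight1_sym {V : finType} (G : sgraph V) (i j : V) b :
  tight1 G i j b -> tight1 G j i b.
Proof. by case=> cov bij; split=> //; rewrite addnC. Qed.

Lemma card_support_le_wt {V : finType} (b : {ffun V -> nat}) (S : {set V}) :
  {in S, forall v, 0 < b v} -> #|S| <= wt b.
Proof.
move=> pos; rewrite -sum1_card /wt big_mkcond; apply: leq_sum => v _.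
by case: ifP => // /pos.
Qed.

Lemma wt_indicator {V : finType} (S : {set V}) :
  wt [ffun v => (v \in S) : nat] = #|S|.
Proof.
by rewrite -sum1_card [RHS]big_mkcond; apply: eq_bigr => v _; rewrite ffunE; case: ifP.
Qed.

(** The union is disjoint because [C] lives on vertices outside [cl_nbh G i], and [val] is
    injective. *)
Lemma card_nbh_setU {V : finType} (G : sgraph V) (i : V)
    (C : {set {x : V | x \notin cl_nbh G i}}) :
  #|nbh G i :|: val @: C| = deg G i + #|C|.
Proof.
rewrite cardsU disjoint_setI0 ?cards0 ?subn0 ?(card_imset _ val_inj) //.
rewrite disjoint_sym disjoints_subset; apply/subsetP => _ /imsetP[x _ ->].
rewrite inE; apply: contra (valP x) => xN; exact: setU1r.
Qed.

Lemma deg_tau_le_wt {V : finType} (G : sgraph V) (i : V) (b : {ffun V -> nat}) :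
  Defs.cover1 G b -> b i = 0 -> deg G i + tau (del G (cl_nbh G i)) <= wt b.
Proof.
move=> cov bi0; pose C := [set x : {x : V | x \notin cl_nbh G i} | 0 < b (val x)].
have coverC : vertex_cover (del G (cl_nbh G i)) C.
  by apply/vertex_coverP => u v Guv; rewrite !inE -addn_gt0; apply: cov.
apply: (@leq_trans #|nbh G i :|: val @: C|).
  by rewrite card_nbh_setU leq_add2l tau_le.
(* Since [b i = 0], the cover inequality on each edge at [i] makes [b] positive on the neighbour; on
   [C] positivity is by construction. *)
apply: card_support_le_wt => v; rewrite inE => /orP[|/imsetP[x]].
  by rewrite mem_nbh => /cov; rewrite bi0.
by rewrite inE => ? ->.
Qed.

Lemma tight1_of_deg_tau {V : finType} (G : sgraph V) (i j : V) : G i j ->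
  exists2 b, tight1 G i j b & wt b = deg G i + tau (del G (cl_nbh G i)).
Proof.
move=> Gij; have [C /vertex_coverP coverC <-] := tau_attained (del G (cl_nbh G i)).
pose S := nbh G i :|: val @: C.
(* This gives tightness: [i] gets weight 0, while its neighbour [j] gets weight 1. *)
have iS : i \notin S.
  rewrite inE mem_nbh adj_irr; apply/imsetP => -[x _ ix].
  by have := valP x; rewrite -ix setU11.
have nbhS v : G i v -> v \in S by rewrite inE mem_nbh => ->.
exists [ffun v => (v \in S) : nat]; last by rewrite wt_indicator card_nbh_setU.
split; last by rewrite !ffunE (negPf iS) nbhS.
move=> u v Guv; rewrite !ffunE addn_gt0 !lt0b.
(* An edge outside [cl_nbh G i] is covered by [C]. Otherwise some endpoint is a neighbour of [i],
   hence in [S], or is [i] itself, and then the other endpoint is in [S]. *)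
have [uN|uN] := boolP (u \in cl_nbh G i); last first.
  have [vN|vN] := boolP (v \in cl_nbh G i); last first.
    have /orP[CS|CS] := coverC (Sub u uN) (Sub v vN) Guv.
      by rewrite inE (imset_f val CS) orbT.
    by rewrite orbC inE (imset_f val CS) orbT.
  move: vN uN; rewrite !in_setU1 !mem_nbh => /orP[/eqP vi|/nbhS ->]; last by rewrite orbT.
  by rewrite -vi adj_sym Guv orbT.
move: uN; rewrite in_setU1 mem_nbh => /orP[/eqP ui|/nbhS -> //].
by rewrite orbC nbhS // -ui.
Qed.

Theorem lemma2p6 (n : nat) (G : sgraph 'I_n)
  (no_isolated : forall v : 'I_n, ~ isolated G v)
  (i j : 'I_n) (Gij : G i j) :
  gamma1 Gij = minn (deg G i + tau (del G (cl_nbh G i)))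
                    (deg G j + tau (del G (cl_nbh G j))).
Proof.
rewrite /gamma1; case: ex_minnP => m /asboolP[b [[cov bij] <-]] minm.
apply/eqP; rewrite eqn_leq leq_min geq_min; apply/andP; split.
  have Gji : G j i by rewrite adj_sym.
  (* Both values are weights of covers tight for the same edge, so the minimum is at most each. *)
  have [c ctight <-] := tight1_of_deg_tau _ _ _ Gij.
  have [d /tight1_sym dtight <-] := tight1_of_deg_tau _ _ _ Gji.
  by apply/andP; split; apply: minm; apply/asboolP; [exists c | exists d].
(* If [b i] is positive, then [b i + b j = 1] leaves [b j = 0], and the lower bound applies at
   [j]. *)
case bi: (b i) bij => [|k]; first by rewrite deg_tau_le_wt.
rewrite addSn => -[] /eqP; rewrite addn_eq0 => /andP[_ /eqP bj].
by rewrite (deg_tau_le_wt G j) ?orbT.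
Qed.
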